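(* Let $n\in\{2,3\}$, and let $d_i=\|a_i-x^o\|+r_i$, $i=1,2,\ldots$, be range measurements of an object at $x^o\in\mathbb R^n$ by sensors at $a_i\in\mathbb R^n$, satisfying assumptions (A1), (A2), (A3), (A6) of the context. For each $m$ let $A\in\mathbb R^{m\times(n+1)}$ be the matrix with $i$-th row $[-2a_i^\top\ \ 1]$ and $\bar b\in\mathbb R^m$ the vector with $i$-th entry $d_i^2-\|a_i\|^2$. Let $D=\begin{bmatrix} I_n&0_{n\times1}\\0_{1\times n}&0\end{bmatrix}$ and $g=\begin{bmatrix}0_{n\times1}\\-0.5\end{bmatrix}$. Let $\hat y^{\rm NE}_m$ be a random vector that is an optimal solution (the Noise-Est estimator) of the convex problem $$\mathop{\rm minimize}_{\bar y\in\mathbb R^{n+1}}\ \|A\bar y-\bar b\|^2\quad\text{subject to}\quad \bar y^\top D\bar y+2g^\top\bar y\le0 .$$ Let $\bar y^o=[{x^o}^\top\ \ \|x^o\|^2+\sigma^2]^\top$. Then the Noise-Est estimator is $\sqrt m$-consistent, i.e. $\hat y^{\rm NE}_m-\bar y^o=O_p(1/\sqrt m)$.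
   Context: $X_m=O_p(\alpha_m)$ means that $X_m/\alpha_m$ is stochastically bounded: for every $\epsilon>0$ there exist finite $M,N$ such that $P(|X_m/\alpha_m|>N)<\epsilon$ for all $m>M$ (with the norm in place of the absolute value for vectors). The sample distribution function of a sequence $(z_1,z_2,\ldots)$ in $\mathbb R^n$ is $F_m(z)=\#\{i\le m: z_i\preceq z\}/m$, where $\preceq$ is the coordinatewise inequality. Assumptions. (A1) The $r_i$ are i.i.d. Gaussian with mean $0$ and finite variance $\sigma^2$. (A2) $x^o$ is an interior point of a compact set $\mathcal X\subset\mathbb R^n$; all the (deterministic) sensor positions $a_i$ lie in a bounded set $\mathcal A\subset\mathbb R^n$, and $a_i\notin\mathcal X$ for each $i$. (A3) The sample distribution function $F_m$ of $(a_1,a_2,\ldots)$ converges to a distribution function $F_\mu$, i.e. $F_m(a)\to F_\mu(a)$ at every continuity point $a\in\mathbb R^n$ of $F_\mu$; $\mu$ denotes the probability measure generated by $F_\mu$. (A6) There is no (affine) line $\mathcal S$ (if $n=2$), respectively plane $\mathcal S$ (if $n=3$), such that $\mu(\mathcal S)=1$. *)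

(* Defs.v *)
From HB Require Import structures.
From mathcomp Require Import all_boot all_order all_algebra.
From mathcomp Require Import all_classical all_reals all_analysis.

Set Implicit Arguments.
Unset Strict Implicit.
Unset Printing Implicit Defensive.

Import Order.TTheory GRing.Theory Num.Theory.
Import numFieldTopology.Exports numFieldNormedType.Exports.

Local Open Scope classical_set_scope.
Local Open Scope ring_scope.

(* The library's norm `|v| on matrices is the sup norm, hence this one. *)
Definition enorm (R : realType) (n : nat) (v : 'cV[R]_n) : R :=
  Num.sqrt (\sum_(j < n) v j 0 ^+ 2).

(* R^n with its Borel sigma-algebra. *)
Definition borel (R : realType) (n : nat) :=
  g_sigma_algebraType (@open 'cV[R]_n).

Definition vle (R : realType) (n : nat) (u v : 'cV[R]_n) : bool :=
  [forall j, u j 0 <= v j 0].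

Definition sample_df (R : realType) (n : nat) (z : nat -> 'cV[R]_n)
    (m : nat) (t : 'cV[R]_n) : R :=
  #|[pred i : 'I_m | vle (z i) t]|%:R / m%:R.

Definition dist_fun (R : realType) (n : nat) (mu : probability (borel R n) R)
    (t : 'cV[R]_n) : R :=
  fine (mu [set x : 'cV[R]_n | vle x t]).

(* k-dimensional affine subspaces of R^n: lines for k = 1, planes for k = 2. *)
Definition affine_subspace (R : realType) (n k : nat) (S : set 'cV[R]_n) :
    Prop :=
  exists (p : 'cV[R]_n) (V : 'M[R]_(n, k)),
    \rank V = k /\ S = [set p + V *m c | c in [set: 'cV[R]_k]].

(* The library's [normal_prob m 0] is, by convention, the uniform law on
   [0, 1]; a Gaussian of variance 0 is the point mass at its mean. *)
Definition gaussian_law (R : realType) (m s : R) (B : set R) : \bar R :=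
  if s == 0 then \d_m B else normal_prob m s B.

Definition mutually_independent (d : measure_display) (T : measurableType d)
    (R : realType) (P : probability T R) (r : nat -> T -> R) : Prop :=
  forall (J : seq nat) (B : nat -> set R), uniq J ->
    (forall i, measurable (B i)) ->
    P (\bigcap_(i in [set` J]) (r i @^-1` B i)) =
    (\prod_(i <- J) P (r i @^-1` B i))%E.

Definition iid_gaussian (d : measure_display) (T : measurableType d)
    (R : realType) (P : probability T R) (r : nat -> {RV P >-> R})
    (m s : R) : Prop :=
  mutually_independent P (fun i => r i : T -> R) /\
  forall (i : nat) (B : set R), measurable B ->
    distribution P (r i) B = gaussian_law m s B.

Definition bigOp (d : measure_display) (T : measurableType d) (R : realType)
    (P : probability T R) (p : nat) (X : nat -> T -> 'cV[R]_p)
    (alpha : nat -> R) : Prop :=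
  forall eps : R, 0 < eps ->
    exists (M : nat) (N : R), forall m : nat, (M < m)%N ->
      (P [set w | (N < enorm ((alpha m)^-1 *: X m w))%R] < eps%:E)%E.

Definition range_meas (R : realType) (n : nat) (a : nat -> 'cV[R]_n)
    (xo : 'cV[R]_n) (r : nat -> R) (i : nat) : R :=
  enorm (a i - xo) + r i.

Definition NE_A (R : realType) (n : nat) (a : nat -> 'cV[R]_n) (m : nat) :
    'M[R]_(m, n + 1) :=
  \matrix_(i < m) row_mx (- 2 *: (a i)^T) 1%:M.

Definition NE_b (R : realType) (n : nat) (a : nat -> 'cV[R]_n)
    (dm : nat -> R) (m : nat) : 'cV[R]_m :=
  \col_(i < m) (dm i ^+ 2 - enorm (a i) ^+ 2).

Definition NE_D (R : realType) (n : nat) : 'M[R]_(n + 1) :=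
  block_mx 1%:M 0 0 0.

Definition NE_g (R : realType) (n : nat) : 'cV[R]_(n + 1) :=
  col_mx 0 (- 2^-1)%:M.

Definition NE_feasible (R : realType) (n : nat) (y : 'cV[R]_(n + 1)) : Prop :=
  (y^T *m NE_D R n *m y + 2 *: ((NE_g R n)^T *m y)) 0 0 <= 0.

Definition NE_optimal (R : realType) (n m : nat) (A : 'M[R]_(m, n + 1))
    (b : 'cV[R]_m) (y : 'cV[R]_(n + 1)) : Prop :=
  NE_feasible y /\
  forall z : 'cV[R]_(n + 1), NE_feasible z ->
    enorm (A *m y - b) ^+ 2 <= enorm (A *m z - b) ^+ 2.

Definition NE_target (R : realType) (n : nat) (xo : 'cV[R]_n) (s : R) :
    'cV[R]_(n + 1) :=
  col_mx xo (enorm xo ^+ 2 + s ^+ 2)%:M.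

(* Main.v *)
Require Import Defs.
From HB Require Import structures.
From mathcomp Require Import all_boot all_order all_algebra.
From mathcomp Require Import all_classical all_reals all_analysis.
From mathcomp Require Import measurable_realfun ring lra.

(* Write h for the error of the estimator and e_i for the centred noise
   2 |a_i - x^o| r_i + r_i^2 - sigma^2.  The true parameter is feasible, so
   optimality gives |A h|^2 <= 2 <A h, e> = 2 <h, A^T e>, without using the
   convexity of the problem.  On the one hand |A h|^2 >= c m |h|^2 for all large
   m: by compactness of the unit sphere it is enough to treat h near a fixed h0;
   as mu charges no hyperplane fully, the affine form attached to h0 is bounded
   away from 0 on some box of positive mu-measure whose faces are mu-null, and
   (A3) makes the sensors visit this box with positive frequency.  On the other
   hand the e_i are centred and uncorrelated with bounded variances, so
   E |A^T e|^2 = O(m).  Hence m |h|^2 <= 4 |A^T e|^2 / (c^2 m), and Markov's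
   inequality concludes. *)

Set Implicit Arguments.
Unset Strict Implicit.
Unset Printing Implicit Defensive.

Import Order.TTheory GRing.Theory Num.Theory.
Import numFieldTopology.Exports numFieldNormedType.Exports.

Local Open Scope classical_set_scope.
Local Open Scope ring_scope.

(** * Moments of the normal law *)

Section gaussian_moments.
Context {R : realType}.
Local Notation leb := (@lebesgue_measure R).

(** [normal_prob] is absolutely continuous, and its Radon-Nikodym derivative agrees almost
    everywhere with [normal_pdf], since both have the same integral over every measurable set. *)
Lemma integral_normal_prob (m s : R) (f : measurableTypeR R -> \bar R) :
  (normal_prob m s).-integrable setT f ->
  (\int[normal_prob m s]_x f x = \int[leb]_x (f x * (normal_pdf m s x)%:E))%E.
Proof.
move=> intf.
have mf := measurable_int _ intf.
rewrite -(Radon_Nikodym_change_of_variables (normal_prob_dominates m s))//=.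
apply: ae_eq_integral => //.
- apply: emeasurable_funM => //; apply: (measurable_int leb).
  by apply: Radon_Nikodym_integrable; exact: normal_prob_dominates.
- apply: emeasurable_funM => //; apply/measurable_EFinP.
  exact: measurable_normal_pdf.
- apply: ae_eqe_mul2l => /=.
  rewrite Radon_NikodymE//=; first exact: normal_prob_dominates.
  move=> dom; case: cid => /= h [h1 h2 h3].
  apply: integral_ae_eq => //=.
  + by apply/measurable_funTS/measurableT_comp => //; exact: measurable_normal_pdf.
  + by move=> E E01 mE; rewrite -h3.
Qed.

(** [integral_normal_prob] presupposes integrability, so it is applied only to the truncations of
    [|f|] at [k], which are bounded, hence integrable for a finite measure. Monotone convergence
    then passes to [|f|]. *)
Lemma integrable_normal_prob (m s : R) (f : measurableTypeR R -> R) :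
  measurable_fun [set: measurableTypeR R] f ->
  leb.-integrable [set: R] (fun x => (f x * normal_pdf m s x)%:E) ->
  (normal_prob m s).-integrable setT (EFin \o f).
Proof.
move=> mf intf.
pose g (k : nat) (x : measurableTypeR R) := (Num.min `|f x| k%:R)%:E : \bar R.
have mg k : measurable_fun [set: measurableTypeR R] (g k).
  apply/measurable_EFinP; apply: measurable_minr => //.
  exact: measurableT_comp.
have g0 k x : (0 <= g k x)%E by rewrite lee_fin le_min normr_ge0 ler0n.
have ndg x : {homo g ^~ x : a b / (a <= b)%N >-> (a <= b)%E}.
  by move=> a b ab; rewrite lee_fin le_min ge_min lexx/= ge_min ler_nat ab orbT.
have cvgg x : (g ^~ x @ \oo --> `|f x|%:E)%E.
  apply: cvg_near_cst; exists (Num.truncn `|f x|).+1 => // k /= hk.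
  rewrite /g min_l//; apply/ltW/(lt_le_trans (truncnS_gt _)).
  by rewrite ler_nat.
apply/integrableP; split; first exact/measurable_EFinP.
have -> : (\int[normal_prob m s]_x `|(EFin \o f) x| =
  \int[normal_prob m s]_x (limn (g^~ x)))%E.
  by apply: eq_integral => x _; rewrite (cvg_lim _ (cvgg x)).
rewrite monotone_convergence//.
apply: (@le_lt_trans _ _ (\int[leb]_x `|(f x * normal_pdf m s x)%:E|)%E);
  last by case/integrableP : intf.
apply: lime_le.
  apply: ereal_nondecreasing_is_cvgn => a b ab.
  by apply: ge0_le_integral => // x _; exact: ndg.
near=> k; rewrite integral_normal_prob; last first.
  apply: (le_integrable measurableT (mg k) (g := cst k%:R%:E)).
    move=> x _; rewrite gee0_abs// /g /= lee_fin [leRHS]ger0_norm//.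
    by rewrite ge_min lexx orbT.
  exact: finite_measure_integrable_cst.
apply: ge0_le_integral => //.
- by move=> x _; rewrite mule_ge0// lee_fin normal_pdf_ge0.
- apply: emeasurable_funM => //; apply/measurable_EFinP.
  exact: measurable_normal_pdf.
- apply: measurableT_comp => //; exact: measurable_int intf.
- move=> x _; rewrite /g -EFinM abse_EFin lee_fin normrM.
  rewrite (ger0_norm (normal_pdf_ge0 _ _ _)) ler_wpM2r ?normal_pdf_ge0//.
  by rewrite ge_min lexx.
Unshelve. all: by end_near. Qed.

(** The fundamental theorem of calculus on growing symmetric intervals leaves only boundary values
    of [F]; dominated convergence identifies the limit with the full integral. *)
Lemma integral_derive_vanishing (F f : R -> R) :
  continuous f -> (forall x : R, is_derive x (1 : R) F (f x)) ->
  leb.-integrable [set: R] (EFin \o f) ->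
  F x @[x --> +oo] --> 0 -> F x @[x --> -oo] --> 0 ->
  (\int[leb]_x (f x)%:E = 0)%E.
Proof.
move=> cf dF intf Fy FNy.
have cF : continuous F.
  by move=> x; apply/differentiable_continuous/derivable1_diffP.
(* Half-length [k + 1] rather than [k]: the interval is never reduced to a point, as
   [continuous_FTC2] requires. *)
pose fn (k : nat) (x : R) := (patch (fun=> 0) `[- k.+1%:R, k.+1%:R]%classic f x)%:E.
have mf := measurable_int _ intf.
have [] := @dominated_convergence _ _ _ leb setT measurableT fn (EFin \o f)
  (fun x => `|f x|%:E).
- move=> k; apply/measurable_EFinP; rewrite -measurable_restrictT//.
  by apply: measurable_funTS; exact/measurable_EFinP.
- exact: mf.
- apply: aeW => x _; apply: cvg_near_cst; exists (Num.truncn `|x|).+1 => // k /= hk.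
  rewrite /fn /patch mem_set//= in_itv/= -ler_norml.
  apply/ltW/(lt_le_trans (truncnS_gt _)).
  by rewrite ler_nat (leq_trans hk).
- exact: integrable_abse intf.
- apply: aeW => x k _; rewrite /fn /patch; case: ifPn => _ //=.
  by rewrite normr0 lee_fin normr_ge0.
move=> _ _ /= cvI.
have cv0 : ([sequence (\int[leb]_x fn n x)%E]_n @ \oo --> 0%E).
  have -> : [sequence (\int[leb]_x fn n x)%E]_n =
     (fun k : nat => (F k.+1%:R - F (- k.+1%:R))%:E).
    apply/funext => k; rewrite /fn /=.
    rewrite -[X in integral _ _ X]/(EFin \o _) -restrict_EFin -integral_mkcond.
    have lt : - k.+1%:R < k.+1%:R :> R by rewrite gtrN.
    rewrite (@continuous_FTC2 _ f F)// ?EFinB//.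
    - exact: continuous_subspaceT.
    - split; first by move=> x _; apply: ex_derive.
      - exact/cvg_at_right_filter/cF.
      - exact/cvg_at_left_filter/cF.
    - by move=> x _; rewrite derive1E; apply: derive_val.
  apply: cvg_EFin; first by near=> k.
  have cvn : (k.+1%:R : R) @[k --> \oo] --> +oo.
    by rewrite (cvg_shiftS (fun k : nat => k%:R : R)); exact: cvgr_idn.
  have cvNn : (- k.+1%:R : R) @[k --> \oo] --> -oo by apply/cvgNrNy.
  rewrite /= -[X in _ --> X](subrr 0); apply: cvgB.
    exact: (cvg_comp _ _ cvn Fy).
  exact: (cvg_comp _ _ cvNn FNy).
exact: (cvg_unique _ cvI cv0).
Unshelve. all: by end_near. Qed.

(* e^u >= (1 + u/2)^2 >= (u/2)^2 *)
Lemma sqr_le_expR (u : R) : 0 <= u -> u ^+ 2 <= 4 * expR u.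
Proof.
move=> u0; have := expR_ge1Dx (u / 2) => e1.
have -> : expR u = expR (u / 2) ^+ 2 by rewrite -expRM_natl -mulr_natr; congr expR; field.
have -> : 4 * expR (u / 2) ^+ 2 = (2 * expR (u / 2)) ^+ 2 by ring.
rewrite ler_pXn2r ?nnegrE ?mulr_ge0 ?expR_ge0//; lra.
Qed.

Lemma normal_pdf0E (s x : R) : s != 0 ->
  normal_pdf 0 s x = normal_peak s * expR (- x ^+ 2 / (s ^+ 2 *+ 2)).
Proof. by move=> s0; rewrite normal_pdfE// /normal_fun subr0. Qed.

(** Trades a factor of degree 4 for a doubled standard deviation. The right-hand side is integrable
    and bounded, which yields both integrability and decay at infinity. *)
Lemma quartic_normal_pdf_le (s : R) : s != 0 ->
  exists2 C : R, 0 <= C &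
    forall x, (1 + x ^+ 4) * normal_pdf 0 s x <= C * normal_pdf 0 (2 * s) x.
Proof.
move=> s0; have s2 : 0 < s ^+ 2 by rewrite exprn_even_gt0.
have t0 : 2 * s != 0 by rewrite mulf_neq0// pnatr_eq0.
have p1 := normal_peak_gt0 s0; have p2 := normal_peak_gt0 t0.
exists ((1 + 4 * (8 * s ^+ 2 / 3) ^+ 2) * (normal_peak s / normal_peak (2 * s))).
  rewrite mulr_ge0 ?divr_ge0 ?(ltW p1) ?(ltW p2)// addr_ge0// mulr_ge0//.
  exact: sqr_ge0.
(* exp(- x^2/(2 s^2)) = exp(- x^2/(8 s^2)) / exp u, and exp u absorbs x^4 *)
move=> x; pose u := 3 * x ^+ 2 / (8 * s ^+ 2).
have u0 : 0 <= u by apply: divr_ge0; apply: mulr_ge0; rewrite ?sqr_ge0//.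
pose v := - x ^+ 2 / ((2 * s) ^+ 2 *+ 2).
have -> : normal_pdf 0 (2 * s) x = normal_peak (2 * s) * expR v.
  by rewrite normal_pdf0E.
have -> : normal_pdf 0 s x = normal_peak s * (expR v / expR u).
  rewrite normal_pdf0E// -expRB; congr (_ * expR _).
  by rewrite /u /v; field.
have x4 : x ^+ 4 = (8 * s ^+ 2 / 3) ^+ 2 * u ^+ 2 by rewrite /u; field.
have lb : 1 + x ^+ 4 <= (1 + 4 * (8 * s ^+ 2 / 3) ^+ 2) * expR u.
  rewrite mulrDl lerD//.
    by rewrite mul1r (le_trans _ (expR_ge1Dx u))// lerDl.
  rewrite x4; move: (8 * s ^+ 2 / 3) => c.
  have := ler_wpM2l (sqr_ge0 c) (sqr_le_expR u0); lra.
move: lb; set K := 1 + 4 * _ => lb.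
have -> : K * (normal_peak s / normal_peak (2 * s)) * (normal_peak (2 * s) * expR v)
    = normal_peak s * (K * expR v) by field; rewrite gt_eqF.
rewrite mulrCA ler_pM2l// mulrA ler_pdivrMr ?expR_gt0// mulrAC.
by rewrite ler_wpM2r ?expR_ge0.
Qed.

Lemma integrable_quartic_normal_pdf (s : R) (f : measurableTypeR R -> R) (K : R) :
  s != 0 -> measurable_fun [set: measurableTypeR R] f ->
  (forall x : R, `|f x| <= K * (1 + x ^+ 4)) ->
  leb.-integrable [set: measurableTypeR R] (fun x => (f x * normal_pdf 0 s x)%:E).
Proof.
move=> s0 mf fK; have [C C0 hC] := quartic_normal_pdf_le s0.
have K0 : 0 <= K.
  by have := fK 0; rewrite expr0n/= addr0 mulr1; apply: le_trans.
have ig := integrableZl measurableT (K * C) (integrable_normal_pdf 0 (2 * s)).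
apply: (le_integrable _ _ _ ig) => //.
- apply/measurable_EFinP; apply: measurable_funM => //.
  exact: measurable_normal_pdf.
- move=> x _; rewrite -EFinM !abse_EFin lee_fin !normrM.
  rewrite !(ger0_norm (normal_pdf_ge0 _ _ _)) (ger0_norm K0) (ger0_norm C0).
  apply: (@le_trans _ _ (K * (1 + x ^+ 4) * normal_pdf 0 s x)).
    by rewrite ler_wpM2r ?normal_pdf_ge0.
  by rewrite -!mulrA ler_wpM2l.
Qed.

Lemma normal_prob_integrable_quartic (s : R) (f : measurableTypeR R -> R) (K : R) :
  s != 0 -> measurable_fun [set: measurableTypeR R] f ->
  (forall x : R, `|f x| <= K * (1 + x ^+ 4)) ->
  (normal_prob 0 s).-integrable [set: measurableTypeR R] (EFin \o f).
Proof.
move=> s0 mf fK; apply: integrable_normal_prob => //.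
exact: integrable_quartic_normal_pdf fK.
Qed.

Lemma cvg0_mul_bounded (F : R -> R) (K : R) : (forall x, `|F x| * `|x| <= K) ->
  F x @[x --> +oo] --> 0 /\ F x @[x --> -oo] --> 0.
Proof.
move=> FK; have K0 : 0 <= K.
  by apply: le_trans (FK 0); rewrite normr0 mulr0.
have main e x : 0 < e -> K / e < `|x| -> `|F x| <= e.
  move=> e0 Kx.
  have x0 : 0 < `|x| by apply: le_lt_trans Kx; rewrite divr_ge0// ltW.
  rewrite -(ler_pM2r x0) (le_trans (FK x))// mulrC -ler_pdivrMr//.
  exact: ltW.
split; apply/cvgr0Pnorm_le => e e0; near=> x; apply: main => //.
  rewrite (lt_le_trans _ (ler_norm x))//; near: x.
  by apply: nbhs_pinfty_gt; exact: num_real.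
rewrite -normrN (lt_le_trans _ (ler_norm (- x)))// ltrNr; near: x.
by apply: nbhs_ninfty_lt; exact: num_real.
Unshelve. all: by end_near. Qed.

Lemma is_derive_normal_pdf (s x : R) : s != 0 ->
  is_derive x (1 : R) (normal_pdf 0 s) (- (x / s ^+ 2) * normal_pdf 0 s x).
Proof.
move=> s0.
have -> : normal_pdf 0 s = (fun=> normal_peak s) *
    (expR \o ((fun=> - (s ^+ 2 *+ 2)^-1) * (@idfun R) ^+ 2)).
  apply/funext => y; rewrite normal_pdf0E// /= !fctE /=; congr (_ * expR _).
  by rewrite mulNr mulrC mulNr.
apply: is_derive_eq.
rewrite !scaler0 !addr0; set E := expR _.
rewrite -[LHS]/(normal_peak s * (E * (- (s ^+ 2 *+ 2)^-1 * (2 * x * 1)))).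
rewrite -[RHS]/(- (x / s ^+ 2) * (normal_peak s * E)).
by field.
Qed.

(** First and second moments at once: as the density [p] satisfies [p' = - (x / s^2) p], the
    integrand times [p] is the derivative of [- s^2 (c + x) p], which vanishes at both
    infinities. *)
Lemma normal_prob_quadratic_mean (s c : R) : s != 0 ->
  (\int[normal_prob 0 s]_x (c * x + (x ^+ 2 - s ^+ 2))%:E = 0)%E.
Proof.
move=> s0; have s2 : 0 < s ^+ 2 by rewrite exprn_even_gt0.
pose q (x : R) : R := c * x + (x ^+ 2 - s ^+ 2).
have x4 (x : R) : `|x| <= 1 + x ^+ 4 /\ x ^+ 2 <= 1 + x ^+ 4.
  have h1 := sqr_ge0 (x ^+ 2 - 1 / 2); have h2 := sqr_ge0 (x - 1 / 2).
  have h3 := sqr_ge0 (x + 1 / 2).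
  by rewrite ler_norml; split; [apply/andP; split|]; nra.
have qK (x : R) : `|q x| <= (`|c| + 1 + s ^+ 2) * (1 + x ^+ 4).
  have [h1 h2] := x4 x; have h4 : 0 <= x ^+ 4 by rewrite exprn_even_ge0.
  rewrite /q (le_trans (ler_normD _ _))// -addrA mulrDl lerD//.
    by rewrite normrM ler_wpM2l.
  rewrite (le_trans (ler_normB _ _))// !ger0_norm ?sqr_ge0// mulrDl mul1r.
  by rewrite lerD// ler_peMr ?sqr_ge0// lerDl.
have mq : measurable_fun [set: measurableTypeR R] q.
  apply: measurable_funD; first exact: measurable_funM.
  by apply: measurable_funB => //; exact: measurable_funX.
rewrite (integral_normal_prob (normal_prob_integrable_quartic s0 mq qK)).
under eq_integral do rewrite -EFinM.
have [C C0 hC] := quartic_normal_pdf_le s0.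
(* an antiderivative of q * normal_pdf 0 s *)
pose F (x : R) := - s ^+ 2 * (c + x) * normal_pdf 0 s x.
(* Here [(|c| + |x|) |x| <= (|c| + 1) (1 + x^4)]; the quartic factor is absorbed by the wider
   density, itself bounded by its peak. *)
have [Fy FNy] : F x @[x --> +oo] --> 0 /\ F x @[x --> -oo] --> 0.
  apply: (@cvg0_mul_bounded F
    (s ^+ 2 * ((`|c| + 1) * (C * normal_peak (2 * s))))) => x.
  have [h1 h2] := x4 x.
  rewrite /F !normrM normrN (ger0_norm (ltW s2)) (ger0_norm (normal_pdf_ge0 _ _ _)).
  rewrite -[leLHS]mulrA -[leLHS]mulrA ler_pM2l// mulrCA mulrC.
  apply: le_trans (_ : (`|c| + 1) * ((1 + x ^+ 4) * normal_pdf 0 s x) <= _).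
    rewrite mulrA ler_wpM2r ?normal_pdf_ge0//.
    apply: le_trans (_ : (`|c| + `|x|) * `|x| <= _).
      by rewrite ler_wpM2r// ler_normD.
    rewrite !mulrDl mul1r lerD//; first exact: ler_wpM2l.
    by rewrite -expr2 real_normK ?num_real.
  rewrite ler_wpM2l ?addr_ge0//.
  apply: le_trans (hC x) _; rewrite ler_wpM2l// normal_pdf_ub//.
  by rewrite mulf_neq0// pnatr_eq0.
apply: (@integral_derive_vanishing F (fun x => q x * normal_pdf 0 s x)); last 2 first.
- exact: Fy.
- exact: FNy.
- move=> x; apply: continuousM; last exact: continuous_normal_pdf.
  apply: continuousD; first by apply: continuousM; [exact: cvg_cst|exact: cvg_id].
  by apply: continuousB; [exact: exprn_continuous|exact: cvg_cst].
- move=> x; have := is_derive_normal_pdf x s0 => ?.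
  apply: is_derive_eq.
  by rewrite /= /GRing.scale /= /q; field.
- exact: integrable_quartic_normal_pdf qK.
Qed.

End gaussian_moments.

(** * Moments of the Gaussian law, zero variance included *)

Section gaussian_law_moments.
Context {R : realType}.
Variables (s : R) (nu : probability (measurableTypeR R) R).
Hypothesis nuE : forall B, measurable B -> nu B = gaussian_law 0 s B.

Lemma gaussian_law_integral (f : measurableTypeR R -> \bar R) :
  (\int[nu]_x f x = if s == 0%R then \int[\d_(0%R : measurableTypeR R)]_x f x
     else \int[normal_prob 0%R s]_x f x)%E.
Proof.
case: ifPn => s0; apply: eq_measure_integral => A mA _.
  by rewrite [LHS]nuE// /gaussian_law s0.
by rewrite [LHS]nuE// /gaussian_law (negbTE s0).
Qed.

Lemma gaussian_law_integrable (f : measurableTypeR R -> R) (K : R) :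
  measurable_fun [set: measurableTypeR R] f ->
  (forall x : R, `|f x| <= K * (1 + x ^+ 4)) ->
  nu.-integrable [set: measurableTypeR R] (EFin \o f).
Proof.
move=> mf fK; have mEf := (measurable_EFinP _ _).2 mf.
apply/integrableP; split => //.
rewrite gaussian_law_integral; case: ifPn => s0.
  rewrite integral_dirac//; last exact: measurableT_comp.
  by rewrite diracT mul1e ltry.
by have /integrableP[] := normal_prob_integrable_quartic s0 mf fK.
Qed.

Lemma gaussian_law_quadratic_mean (c : R) :
  (\int[nu]_x (c * x + (x ^+ 2 - s ^+ 2))%:E = 0)%E.
Proof.
rewrite gaussian_law_integral; case: ifPn => [/eqP s0|s0].
  rewrite integral_dirac//.
    by rewrite diracT s0 mulr0 expr0n subrr addr0 mul1e.
  apply/measurable_EFinP; apply: measurable_funD; first exact: measurable_funM.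
  by apply: measurable_funB => //; exact: measurable_funX.
exact: normal_prob_quadratic_mean.
Qed.

End gaussian_law_moments.

(** * Second moment of sums of independent noises *)

Section second_moment.
Context d (T : measurableType d) (R : realType) (P : probability T R).

(** Expanding the square gives a double sum whose off-diagonal terms integrate to 0. The bound is
    thus linear in the number of terms when the weights are bounded. *)
Lemma integral_sqr_sum_uncorrelated (e : nat -> T -> R) (K : R) :
  (forall i j, P.-integrable [set: T] (fun w => (e i w * e j w)%:E)) ->
  (forall i j, i != j -> (\int[P]_w (e i w * e j w)%:E = 0)%E) ->
  (forall i, (\int[P]_w (e i w * e i w)%:E <= K%:E)%E) ->
  forall (c : nat -> R) (m : nat),
  P.-integrable [set: T] (fun w => ((\sum_(i < m) c i * e i w) ^+ 2)%:E) /\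
  (\int[P]_w ((\sum_(i < m) c i * e i w) ^+ 2)%:E
     <= (K * \sum_(i < m) c i ^+ 2)%:E)%E.
Proof.
move=> ie e0 eK c m.
have sqE : (fun w => ((\sum_(i < m) c i * e i w) ^+ 2)%:E) =
    (fun w => \sum_(i < m) \sum_(j < m) (c i * c j)%:E * (e i w * e j w)%:E)%E.
  apply/funext => w; rewrite expr2 mulr_suml -sumEFin; apply: eq_bigr => i _.
  rewrite mulr_sumr -sumEFin; apply: eq_bigr => j _.
  by rewrite -EFinM; congr (_%:E); ring.
have icc i j : P.-integrable [set: T] (fun w => (c i * c j)%:E * (e i w * e j w)%:E)%E.
  exact: integrableZl.
have isum (i : 'I_m) : P.-integrable [set: T]
    (fun w => \sum_(j < m) (c i * c j)%:E * (e i w * e j w)%:E)%E.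
  by apply: integrable_sum => // j _; exact: icc.
rewrite sqE; split; first by apply: integrable_sum => // i _; exact: isum.
rewrite integral_sum//.
rewrite mulr_sumr -sumEFin; apply: lee_sum => i _.
rewrite integral_sum//.
rewrite (bigD1 i)//= big1 ?adde0; last first.
  by move=> j ji; rewrite integralZl// e0 ?mule0// eq_sym.
rewrite integralZl// -expr2 [K * _]mulrC [leRHS]EFinM; apply: lee_wpmul2l => //.
by rewrite lee_fin sqr_ge0.
Qed.

End second_moment.

(** * Expectation of a product of independent variables *)

Section independence.
Context d (T : measurableType d) (R : realType) (P : probability T R).
Context d1 d2 (T1 : measurableType d1) (T2 : measurableType d2).

(** Independence says that the law of the pair [(X, Y)] agrees on rectangles with the product of the
    two laws, so the measures coincide; Tonelli gives integrability and Fubini the value. *)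
Lemma integral_mul_independent (X : {mfun T >-> T1}) (Y : {mfun T >-> T2})
    (f : T1 -> R) (g : T2 -> R) :
  (forall A B, measurable A -> measurable B ->
    P (X @^-1` A `&` Y @^-1` B) = (P (X @^-1` A) * P (Y @^-1` B))%E) ->
  (distribution P X).-integrable [set: T1] (EFin \o f) ->
  (distribution P Y).-integrable [set: T2] (EFin \o g) ->
  P.-integrable [set: T] (fun w => (f (X w) * g (Y w))%:E) /\
  (\int[P]_w (f (X w) * g (Y w))%:E =
    \int[distribution P X]_x (f x)%:E * \int[distribution P Y]_y (g y)%:E)%E.
Proof.
move=> indep intf intg.
pose Z w := (X w, Y w).
have mZ : measurable_fun [set: T] Z by exact: measurable_fun_pair.
have mZset : Z \in mfun by rewrite inE.
pose Z' : {mfun T >-> (T1 * T2)%type} := mfun_Sub mZset.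
have mf : measurable_fun setT f by apply/measurable_EFinP; exact: measurable_int intf.
have mg : measurable_fun setT g by apply/measurable_EFinP; exact: measurable_int intg.
pose h (z : T1 * T2) := (f z.1 * g z.2)%:E.
have mh : measurable_fun setT h.
  apply/measurable_EFinP; apply: measurable_funM.
    exact: measurableT_comp mf measurable_fst.
  exact: measurableT_comp mg measurable_snd.
have prodE A : measurable A ->
    (distribution P X \x distribution P Y)%E A = distribution P Z' A.
  by apply: product_measure_unique => B C mB mC; rewrite -indep.
have ih : (distribution P X \x distribution P Y)%E.-integrable setT h.
  apply/integrable12ltyP => //.
  have /integrableP[_ fy] := intf; have /integrableP[_ gy] := intg.
  under eq_integral => x _.
    under eq_integral => y _ do rewrite /h /= normrM EFinM.
    rewrite ge0_integralZl//; last first.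
      by apply/measurable_EFinP; exact: measurableT_comp.
    over.
  rewrite /= ge0_integralZr//.
  - by rewrite lte_mul_pinfty// ?integral_ge0// ge0_fin_numE// integral_ge0.
  - by apply/measurable_EFinP; exact: measurableT_comp.
  - exact: integral_ge0.
have iZ : P.-integrable setT (h \o Z).
  apply/integrableP; split; first exact: measurableT_comp.
  rewrite -(@ge0_integral_distribution _ _ _ _ _ P Z' (abse \o h))//; first last.
  - by move=> z; exact: abse_ge0.
  - exact: measurableT_comp.
  rewrite -(eq_measure_integral _ (fun A mA _ => prodE A mA)).
  by case/integrableP : ih.
split=> //.
rewrite -[LHS](@integral_distribution _ _ _ _ _ P Z' h)//.
rewrite -(eq_measure_integral _ (fun A mA _ => prodE A mA)).
rewrite -integral12_prod_meas1// /fubini_F.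
under eq_integral => x _.
  under eq_integral => y _ do rewrite /h /= EFinM.
  rewrite integralZl//; over.
have gfin := integrable_fin_num measurableT intg.
by rewrite -(fineK gfin) integralZr.
Qed.

End independence.

(** * Second moment of weighted sums of the centred noises *)

Section gaussian_noise.
Context d (T : measurableType d) (R : realType) (P : probability T R).
Variables (r : nat -> {RV P >-> R}) (s : R).
Hypothesis A1 : iid_gaussian r 0 s.

Lemma iid_gaussian_pairwise (i j : nat) (A B : set R) :
  i != j -> measurable A -> measurable B ->
  P (r i @^-1` A `&` r j @^-1` B) = (P (r i @^-1` A) * P (r j @^-1` B))%E.
Proof.
move=> ij mA mB; pose C k := if k == i then A else B.
have Ci : C i = A by rewrite /C eqxx.
have Cj : C j = B by rewrite /C eq_sym (negbTE ij).
have mC k : measurable (C k) by rewrite /C; case: ifP.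
have uij : uniq [:: i; j] by rewrite /= inE ij.
have := A1.1 _ _ uij mC; rewrite 2!big_cons big_nil mule1 Ci Cj => <-.
congr (P _); apply/seteqP; split=> [w [Aw Bw] k /=|w H].
  by rewrite !inE => /orP[] /eqP ->; rewrite ?Ci ?Cj.
split.
  by have := H i; rewrite /= inE eqxx Ci; exact.
by have := H j; rewrite /= !inE eqxx orbT Cj; exact.
Qed.

(** The point is that [K] depends neither on the weights nor on [m]. Each summand has square at most
    [K0 (1 + x^4)] uniformly in [i], and distinct summands are uncorrelated because they are
    independent and centred. *)
Lemma gaussian_noise_second_moment (rho : nat -> R) (rho0 : R) :
  (forall i, `|rho i| <= rho0) ->
  exists2 K : R, 0 <= K & forall (c : nat -> R) (m : nat),
    let W w := \sum_(i < m) c i * (rho i * r i w + (r i w ^+ 2 - s ^+ 2)) in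
    P.-integrable [set: T] (fun w => (W w ^+ 2)%:E) /\
    (\int[P]_w (W w ^+ 2)%:E <= (K * \sum_(i < m) c i ^+ 2)%:E)%E.
Proof.
move=> rho_le; have rho0_ge0 : 0 <= rho0 := le_trans (normr_ge0 _) (rho_le 0%N).
(* R and measurableTypeR R have the same measurable sets but different displays:
   X i is r i retyped, so that its law can be compared with normal_prob. *)
have mr i : (r i : T -> measurableTypeR R) \in mfun.
  by rewrite inE /=; exact: (@measurable_funP _ _ _ _ setT (r i)).
pose X i : {mfun T >-> measurableTypeR R} := mfun_Sub (mr i).
pose nu i : probability (measurableTypeR R) R := distribution P (X i).
have nuE i B : measurable B -> nu i B = gaussian_law 0 s B by exact: A1.2.
pose f i (x : measurableTypeR R) : R := rho i * x + (x ^+ 2 - s ^+ 2).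
pose K0 := 3 * (rho0 ^+ 2 + 1 + s ^+ 4).
have K0_ge0 : 0 <= K0.
  by rewrite /K0 mulr_ge0// !addr_ge0// ?sqr_ge0// exprn_even_ge0.
have mf i : measurable_fun [set: measurableTypeR R] (f i).
  apply: measurable_funD; first exact: measurable_funM.
  by apply: measurable_funB => //; exact: measurable_funX.
have f2K i x : f i x ^+ 2 <= K0 * (1 + x ^+ 4).
  rewrite /f /K0; have r1 : rho i ^+ 2 <= rho0 ^+ 2.
    by rewrite -[leLHS]real_normK ?num_real// ler_pXn2r ?nnegrE.
  move: (rho i) r1 => c c2.
  have sq3 (a b e : R) : (a + (b - e)) ^+ 2 <= 3 * (a ^+ 2 + b ^+ 2 + e ^+ 2).
    by have := sqr_ge0 (a - b); have := sqr_ge0 (a + e); have := sqr_ge0 (b + e); nra.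
  apply: le_trans (sq3 _ _ _) _; rewrite -mulrA ler_pM2l//.
  have h1 := sqr_ge0 (x ^+ 2 - 1 / 2); have h4 : 0 <= x ^+ 4 by rewrite exprn_even_ge0.
  have h5 : 0 <= s ^+ 4 by rewrite exprn_even_ge0.
  have x2 : x ^+ 2 <= 1 + x ^+ 4 by nra.
  have c3 := sqr_ge0 rho0.
  rewrite exprMn -!exprM !mulrDl mul1r !lerD//.
  - apply: le_trans (ler_wpM2r (sqr_ge0 x) c2) _; exact: ler_wpM2l.
  - by rewrite lerDr.
  - by rewrite ler_peMr// lerDl.
have fK i x : `|f i x| <= (K0 + 1) * (1 + x ^+ 4).
  have h4 : 0 <= x ^+ 4 by rewrite exprn_even_ge0.
  apply: le_trans (_ : f i x ^+ 2 + 1 <= _).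
    have := sqr_ge0 (f i x - 1); have := sqr_ge0 (f i x + 1).
    by rewrite ler_norml => *; apply/andP; split; nra.
  by rewrite mulrDl mul1r lerD// lerDl.
have if1 i : (nu i).-integrable [set: measurableTypeR R] (EFin \o f i).
  exact: gaussian_law_integrable (nuE i) _ _ (mf i) (fK i).
have if2 i : (nu i).-integrable [set: measurableTypeR R] (fun x => (f i x ^+ 2)%:E).
  apply: (gaussian_law_integrable (nuE i) (K := K0)).
    exact: measurable_funX.
  by move=> x; rewrite ger0_norm ?sqr_ge0.
have i4 i : (nu i).-integrable [set: measurableTypeR R] (fun x => (1 + x ^+ 4)%:E).
  apply: (gaussian_law_integrable (nuE i) (K := 1)).
    by apply: measurable_funD => //; exact: measurable_funX.
  by move=> x; rewrite mul1r ger0_norm// addr_ge0// exprn_even_ge0.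
(* All [nu i] are the same law, so the fourth moment taken at index 0 serves for every [i]. *)
pose K := (K0 * fine (\int[nu 0%N]_x (1 + x ^+ 4)%:E)%E).
have K_ge0 : 0 <= K.
  rewrite mulr_ge0// fine_ge0// integral_ge0// => x _.
  by rewrite lee_fin addr_ge0// exprn_even_ge0.
have int_le i : (\int[nu i]_x (f i x ^+ 2)%:E <= K%:E)%E.
  rewrite /K EFinM fineK; last exact: integrable_fin_num (i4 0%N).
  rewrite -(integralZl measurableT (i4 0%N)).
  rewrite (_ : (\int[nu 0%N]_x _)%E = (\int[nu i]_x (K0%:E * (1 + x ^+ 4)%:E))%E).
    apply: ge0_le_integral => //.
    - by move=> x _; rewrite lee_fin sqr_ge0.
    - exact: measurable_int (if2 i).
    - by apply: measurable_int; apply: integrableZl => //; exact: i4.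
    - by move=> x _; rewrite -EFinM lee_fin.
  apply: eq_measure_integral => A mA _; rewrite [LHS]nuE// [RHS]nuE//.
have mfX i : measurable_fun [set: T] (fun w => f i (X i w)).
  by apply: measurableT_comp.
have sqE i : (\int[P]_w (f i (X i w) ^+ 2)%:E = \int[nu i]_x (f i x ^+ 2)%:E)%E.
  rewrite [RHS]ge0_integral_distribution//.
    by apply/measurable_EFinP; exact: measurable_funX.
  by move=> x; rewrite lee_fin sqr_ge0.
have sqi i : P.-integrable [set: T] (fun w => (f i (X i w) ^+ 2)%:E).
  apply/integrableP; split; first by apply/measurable_EFinP; exact: measurable_funX.
  under eq_integral do rewrite gee0_abs ?lee_fin ?sqr_ge0//.
  by rewrite sqE (le_lt_trans (int_le i))// ltry.
have ind i j : i != j -> forall A B : set (measurableTypeR R),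
    measurable A -> measurable B ->
    P (X i @^-1` A `&` X j @^-1` B) = (P (X i @^-1` A) * P (X j @^-1` B))%E.
  by move=> ij A B; exact: iid_gaussian_pairwise.
have prod i j (ij : i != j) := integral_mul_independent (ind i j ij) (if1 i) (if1 j).
exists K => // c m W.
apply: (@integral_sqr_sum_uncorrelated _ _ _ _ (fun i w => f i (X i w))).
- move=> i j; have [->|ij] := eqVneq i j; first exact: sqi.
  by have [] := prod i j ij.
- move=> i j ij; have [_ ->] := prod i j ij.
  by rewrite (gaussian_law_quadratic_mean (nuE i)) mul0e.
- by move=> i; rewrite (le_trans _ (int_le i))// -sqE.
Qed.

End gaussian_noise.

(** * Continuity points of a multivariate distribution function *)

Section borel_coordinates.
Context {R : realType} {n : nat}.

Lemma measurable_borel_open (A : set 'cV[R]_n) :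
  open A -> measurable (A : set (borel R n)).
Proof. by move=> oA; exact: sub_sigma_algebra. Qed.

Lemma measurable_coord (j : 'I_n) :
  measurable_fun [set: borel R n] (fun x : borel R n => (x : 'cV[R]_n) j 0 : R).
Proof.
move=> mT; apply: (measurability _ (RGenOInfty.measurableE R)) => //.
move=> _ [_ [t ->] <-]; rewrite setTI; apply: measurable_borel_open.
have := @coord_continuous R n 1 j 0.
by move/continuousP; apply; exact: interval_open.
Qed.

Definition coord_mfun (j : 'I_n) : {mfun borel R n >-> R} :=
  mfun_Sub (mem_set (@measurable_coord j :
    [set f | measurable_fun setT f] (fun x : borel R n => (x : 'cV[R]_n) j 0 : R))).

(** A point all of whose coordinates are generic is a continuity point of [dist_fun mu], so (A3)
    applies there. *)
Definition generic (mu : probability (borel R n) R) (j : 'I_n) (t : R) : Prop :=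
  mu [set x | (x : 'cV[R]_n) j 0 = t] = 0%E.

(** Each coordinate has countably many atoms under [mu]. Their rational translates form a countable,
    hence Lebesgue-null, set, which cannot cover [[0, 1]]; any [tau] outside it makes the dense grid
    [tau + Q] generic in all coordinates at once. *)
Lemma exists_generic_shift (mu : probability (borel R n) R) :
  exists tau : R, forall (j : 'I_n) (q : rat), generic mu j (tau + ratr q).
Proof.
pose B j := [set t | 0 < pmf (P := mu) (coord_mfun j) t].
have cB j : countable (B j) by exact: pmf_gt0_countable.
pose C := \bigcup_(jq in [set: 'I_n * rat]) [set t - ratr jq.2 | t in B jq.1].
have cC : countable C.
  apply: bigcup_countable; first exact: countableP.
  by move=> jq _; apply: sub_countable (cB jq.1); exact: card_image_le.
have [tau notC] : exists tau, ~ C tau.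
  apply: contrapT => /forallNP allC.
  have : lebesgue_measure (`[0, 1]%classic : set R) = 0%E.
    apply: countable_lebesgue_measure0; apply: sub_countable cC.
    apply: subset_card_le => x _; exact: contrapT (allC x).
  by rewrite lebesgue_measure_itv/= lte01 oppr0 adde0 => /eqP; rewrite eqe oner_eq0.
exists tau => j q; apply/eqP; rewrite -measure_le0 leNgt; apply/negP => mu0.
apply: notC; exists (j, q) => //=; exists (tau + ratr q); last by rewrite addrK.
rewrite /B /= /pmf fine_gt0//; apply/andP; split; first exact: mu0.
by rewrite (le_lt_trans (probability_le1 _ _)) ?ltry//; exact: measurable_funPTI.
Qed.

Lemma measurable_forall_coord (I : 'I_n -> set R) :
  (forall j, measurable (I j)) ->
  measurable ([set x | forall j, I j ((x : 'cV[R]_n) j 0)] : set (borel R n)).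
Proof.
move=> mI.
have -> : [set x | forall j, I j ((x : 'cV[R]_n) j 0)] =
    \bigcap_(j in [set: 'I_n]) (coord_mfun j @^-1` I j).
  by apply/seteqP; split=> x Ix j //=; exact: Ix.
apply: fin_bigcap_measurable; first exact: finite_finset.
by move=> j _; exact: measurable_funPTI.
Qed.

Lemma vleP (x t : 'cV[R]_n) : reflect (forall j, x j 0 <= t j 0) (vle x t).
Proof. exact: forallP. Qed.

Lemma measurable_vle (u : 'cV[R]_n) :
  measurable ([set x | vle x u] : set (borel R n)).
Proof.
rewrite (_ : [set x | vle x u] =
    [set x | forall j, `]-oo, u j 0]%classic ((x : 'cV[R]_n) j 0)]).
  by apply: (measurable_forall_coord (I := fun j => `]-oo, u j 0]%classic)).
apply/seteqP; split=> x /= => [/vleP H j|H].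
  by rewrite in_itv/= H.
by apply/vleP => j; have := H j; rewrite in_itv.
Qed.

Lemma measure_bigsetU_seq_le (mu : {measure set (borel R n) -> \bar R})
    (I : Type) (l : seq I) (A : I -> set (borel R n)) :
  (forall i, measurable (A i)) ->
  (mu (\big[setU/set0]_(i <- l) A i) <= \sum_(i <- l) mu (A i))%E.
Proof.
move=> mA; elim: l => [|i l IH]; first by rewrite !big_nil measure0.
have mU : measurable (\big[setU/set0]_(i <- l) A i) by exact: bigsetU_measurable.
by rewrite !big_cons (le_trans (measureU2 mu (mA i) mU))// leeD2l.
Qed.

Definition slab (j : 'I_n) (t : R) (k : nat) : set (borel R n) :=
  coord_mfun j @^-1` `[t - k.+1%:R^-1, t + k.+1%:R^-1].

Lemma measurable_slab j t k : measurable (slab j t k).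
Proof. by exact: measurable_funPTI. Qed.

(** The slabs decrease to the hyperplane where coordinate [j] equals [t], which is null by
    genericity; this is continuity from above. *)
Lemma slab_cvg0 (mu : probability (borel R n) R) (j : 'I_n) (t : R) :
  generic mu j t -> fine (mu (slab j t k)) @[k --> \oo] --> (0 : R).
Proof.
move=> gt; have capE : \bigcap_k slab j t k = [set x | (x : 'cV[R]_n) j 0 = t].
  apply/seteqP; split=> [x sx|x /= xt k _]; last first.
    by rewrite /slab /= in_itv/= xt lerDl invr_ge0 lerBlDr lerDl invr_ge0 ler0n.
  apply/eqP; rewrite -subr_eq0 -normr_eq0 -normr_le0 leNgt; apply/negP => lt0.
  have [k hk] := ltr_add_invr lt0; rewrite add0r in hk.
  have := sx k I; rewrite /slab /= in_itv/= -ler_distlC distrC.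
  by move=> h; move: hk; rewrite normr_id ltNge h.
have : (mu \o slab j t) k @[k --> \oo] --> mu (\bigcap_k slab j t k).
  apply: nonincreasing_cvg_mu.
  - by rewrite (le_lt_trans (probability_le1 _ _)) ?ltry//; exact: measurable_slab.
  - by move=> k; exact: measurable_slab.
  - by apply: bigcapT_measurable => k; exact: measurable_slab.
  - move=> a b ab; apply/subsetPset => x; rewrite /slab /= !in_itv/= => /andP[h1 h2].
    have ba : b.+1%:R^-1 <= a.+1%:R^-1 :> R by rewrite lef_pV2 ?posrE// ler_nat.
    by apply/andP; split; [apply: le_trans h1|apply: le_trans h2 _];
      rewrite lerD2l// lerN2.
rewrite capE (gt : mu _ = _) => cv0.
exact: (fine_cvg cv0).
Qed.

(** A point below [u] but not below [t] has some coordinate above that of [t], hence lies in a slab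
    around [c]. The centre [c] is kept apart from [t] and [u] so that the bound can be used in both
    directions. *)
Lemma dist_fun_le_slabs (mu : probability (borel R n) R) (k : nat) (t u : 'cV[R]_n)
    (c : 'cV[R]_n) :
  (forall j, c j 0 - k.+1%:R^-1 <= t j 0 /\ u j 0 <= c j 0 + k.+1%:R^-1) ->
  dist_fun mu u <= dist_fun mu t + \sum_j fine (mu (slab j (c j 0) k)).
Proof.
move=> tu; rewrite -lee_fin EFinD -sumEFin /dist_fun.
have fin_slab j : (fine (mu (slab j (c j 0) k)))%:E = mu (slab j (c j 0) k).
  by rewrite fineK// fin_num_measure//; exact: measurable_slab.
rewrite (eq_bigr (fun j => mu (slab j (c j 0) k))); last by move=> j _; exact: fin_slab.
rewrite !fineK ?fin_num_measure//; [|exact: measurable_vle..].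
apply: (@le_trans _ _ (mu ([set x | vle x t] `|`
   \big[setU/set0]_j slab j (c j 0) k))).
  apply: le_measure.
  - by rewrite inE; exact: measurable_vle.
  - rewrite inE; apply: measurableU; first exact: measurable_vle.
    by apply: bigsetU_measurable => j _; exact: measurable_slab.
  - move=> x /= /vleP xu; have [xt|nxt] := boolP (vle x t); [by left|right].
    move: nxt; rewrite /vle negb_forall => /existsP[j]; rewrite -ltNge => tx.
    rewrite (bigD1 j)//=; left; rewrite /slab /= in_itv/=.
    have [h1 h2] := tu j; apply/andP.
    by split; [apply/ltW/(le_lt_trans h1)|exact: le_trans h2].
have mU : measurable (\big[setU/set0]_j slab j (c j 0) k).
  by apply: bigsetU_measurable => j _; exact: measurable_slab.
rewrite (le_trans (measureU2 mu (measurable_vle t) mU))// leeD2l//.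
by apply: measure_bigsetU_seq_le => j; exact: measurable_slab.
Qed.

(** On the sup-norm ball of radius [1/(k+1)] around [t], [dist_fun mu] varies by at most the total
    mass of the slabs through [t], which tends to 0. *)
Lemma dist_fun_continuous (mu : probability (borel R n) R) (t : 'cV[R]_n) :
  (forall j, generic mu j (t j 0)) -> {for t, continuous (dist_fun mu)}.
Proof.
move=> gt; have : \sum_j fine (mu (slab j (t j 0) k)) @[k --> \oo] --> (0 : R).
  rewrite [X in _ --> X](_ : 0 = \sum_(j < n) 0 :> R); last by rewrite big1.
  by apply: cvg_big => [|j _]; [exact: add_continuous|exact: slab_cvg0].
move=> /cvgr0Pnorm_le cv0; rewrite /prop_for /continuous_at.
apply/(@cvgrPdist_le _ _ _ _ (nbhs_filter t)) => e e0.
have [k _ /(_ k (leqnn _)) hk] := cv0 e e0.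
have := hk; rewrite ger0_norm; last by apply: sumr_ge0 => j _; exact: fine_ge0.
move=> {}hk; have : \forall u \near t, ball t k.+1%:R^-1 u.
  by apply: nbhsx_ballx; rewrite invr_gt0.
apply: filterS => u [_ tu].
have tu1 j : t j 0 - k.+1%:R^-1 <= u j 0 /\ u j 0 <= t j 0 + k.+1%:R^-1.
  by have /ltW := tu j 0; rewrite ler_distlC => /andP.
have h1 := @dist_fun_le_slabs mu k t u t.
have h2 := @dist_fun_le_slabs mu k u t t.
rewrite ler_distlC lerBlDr; apply/andP; split.
  rewrite (le_trans (h2 _))// ?lerD2l// => j; split; first by have [] := tu1 j.
  by rewrite lerDl invr_ge0.
rewrite (le_trans (h1 _))// ?lerD2l// => j; split; last by have [] := tu1 j.
by rewrite lerBlDr lerDl invr_ge0.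
Qed.

End borel_coordinates.

(** * Asymptotic frequencies of boxes *)

Section box_frequencies.
Context {R : realType} {n : nat}.

(* The lower bounds only concern the first k coordinates, so that box k.+1 is a
   difference of two boxes k: this induction replaces inclusion-exclusion. *)
Definition box (k : nat) (s t x : 'cV[R]_n) : bool :=
  [forall j : 'I_n, (x j 0 <= t j 0) && ((j < k)%N ==> (s j 0 < x j 0))].

Lemma boxP k (s t x : 'cV[R]_n) : reflect
  (forall j : 'I_n, x j 0 <= t j 0 /\ ((j < k)%N -> s j 0 < x j 0)) (box k s t x).
Proof.
apply: (iffP forallP) => H j; have := H j.
  by move=> /andP[? /implyP].
by move=> [-> h]; apply/implyP.
Qed.

Lemma box0 (s t x : 'cV[R]_n) : box 0 s t x = vle x t.
Proof. by apply: eq_forallb => j; rewrite implyFb andbT. Qed.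

Lemma measurable_box k (s t : 'cV[R]_n) :
  measurable ([set x | box k s t x] : set (borel R n)).
Proof.
pose I (j : 'I_n) : set R :=
  `]-oo, t j 0] `&` (if (j < k)%N then `]s j 0, +oo[%classic else setT).
rewrite (_ : [set x | box k s t x] =
    [set x | forall j, I j ((x : 'cV[R]_n) j 0)]).
  apply: measurable_forall_coord => j; apply: measurableI => //.
  by case: ifP.
apply/seteqP; split=> x /= => [/boxP H j|H].
  have [h1 h2] := H j; rewrite /I /= in_itv/= h1; split=> //.
  by case: ifP => // jk; rewrite /= in_itv/= andbT h2.
apply/boxP => j; have [] := H j; rewrite /= in_itv/= => h1 h2; split=> // jk.
by move: h2; rewrite jk /= in_itv/= andbT.
Qed.

Definition freq (a : nat -> 'cV[R]_n) (Q : 'cV[R]_n -> bool) (m : nat) : R :=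
  (\sum_(i < m) (Q (a i))%:R) / m%:R.

Lemma sample_dfE a m t : sample_df a m t = freq a (fun x => vle x t) m.
Proof.
rewrite /sample_df /freq -sum1_card natr_sum; congr (_ / _).
by rewrite big_mkcond; apply: eq_bigr => i _; rewrite inE /=; case: vle.
Qed.

Variables (mu : probability (borel R n) R) (a : nat -> 'cV[R]_n).
Hypothesis A3 : forall t : 'cV[R]_n, {for t, continuous (dist_fun mu)} ->
  sample_df a m t @[m --> \oo] --> dist_fun mu t.

(** The induction only ever produces upper corners with generic coordinates, so the base case is
    always (A3) at a continuity point. *)
Lemma box_freq_cvg k (s t : 'cV[R]_n) : (k <= n)%N ->
  (forall j, generic mu j (s j 0) /\ generic mu j (t j 0) /\ s j 0 <= t j 0) ->
  freq a (box k s t) m @[m --> \oo] --> fine (mu [set x | box k s t x]).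
Proof.
elim: k t => [|k IH] t kn gst.
  have cv := A3 (dist_fun_continuous (fun j => (gst j).2.1)).
  rewrite (_ : box 0 s t = (fun x => vle x t)); last by apply/funext => x; exact: box0.
  by under eq_fun do rewrite -sample_dfE; exact: cv.
(* [t'] lowers coordinate [k] of [t] to that of [s]: the box [k] with corner [t'] is exactly what
   must be removed to impose the next strict lower bound. Equality of the corners in that coordinate
   is why the hypothesis has [<=]. *)
pose j0 := Ordinal kn; pose t' : 'cV[R]_n := \col_j if j == j0 then s j 0 else t j 0.
have gst' j : generic mu j (s j 0) /\ generic mu j (t' j 0) /\ s j 0 <= t' j 0.
  by have [h1 [h2 h3]] := gst j; rewrite mxE; case: eqP.
have sub x : box k s t' x -> box k s t x.
  move=> /boxP H; apply/boxP => j; have [h1 h2] := H j; split=> //.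
  apply: le_trans h1 _; rewrite mxE; case: eqP => [->|//].
  by have [_ []] := gst j0.
have boxS x : box k.+1 s t x = box k s t x && ~~ box k s t' x.
  apply/idP/idP => [/boxP H|/andP[/boxP H nb]].
    apply/andP; split.
      by apply/boxP => j; have [h1 h2] := H j; split=> // jk; apply/h2/ltnW.
    apply/negP => /boxP /(_ j0) [+ _]; rewrite mxE eqxx leNgt.
    by have [_ ->] := H j0.
  apply/boxP => j; have [h1 h2] := H j; split=> //.
  rewrite ltnS leq_eqVlt => /orP[/eqP jk|/h2//].
  have jj0 : j = j0 by exact: val_inj.
  rewrite jj0 ltNge; apply: contra nb => xs; apply/boxP => i; have [h1i h2i] := H i.
  by split=> //; rewrite mxE; case: eqP => [->|].
have freqE m : freq a (box k.+1 s t) m = freq a (box k s t) m - freq a (box k s t') m.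
  rewrite /freq -mulrBl -sumrB; congr (_ / _); apply: eq_bigr => i _.
  rewrite boxS; have := sub (a i); case: (box k s t' (a i)); case: (box k s t (a i)) => //=.
  - by rewrite subrr.
  - by move=> /(_ isT).
  - by rewrite subr0.
  - by rewrite subrr.
have muE : fine (mu [set x | box k.+1 s t x]) =
    fine (mu [set x | box k s t x]) - fine (mu [set x | box k s t' x]).
  have -> : [set x | box k.+1 s t x] = [set x | box k s t x] `\` [set x | box k s t' x].
    apply/seteqP; split=> [x|x [bx /negP nb]]; rewrite /= boxS.
      by move=> /andP[? /negP].
    by apply/andP.
  rewrite measureD; [|exact: measurable_box..|].
    rewrite setIidr; last exact: sub.
    by rewrite fineB// fin_num_measure//; exact: measurable_box.
  by rewrite (le_lt_trans (probability_le1 _ _)) ?ltry//; exact: measurable_box.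
rewrite muE; under eq_fun do rewrite freqE.
by apply: cvgB; apply: IH => //; exact: ltnW.
Qed.

(** An open set is the union of the boxes it contains with corners on the grid [tau + Q]. There are
    countably many of them, so they cannot all be null when [U] has positive mass. *)
Lemma exists_generic_box (U : set 'cV[R]_n) :
  open U -> (0 < mu (U : set (borel R n)))%E ->
  exists s t : 'cV[R]_n, [/\
    forall j, generic mu j (s j 0) /\ generic mu j (t j 0) /\ s j 0 <= t j 0,
    forall x, box n s t x -> U x & 0 < fine (mu [set x | box n s t x])].
Proof.
move=> oU muU; have [tau gtau] := exists_generic_shift mu.
pose S (p : 'cV[rat]_n) : 'cV[R]_n := \col_j (tau + ratr (p j 0)).
apply: contrapT => noBox.
(* Enumerates, through codes of pairs of rational vectors, the grid boxes contained in [U]; all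
   other integers give the empty set. *)
pose F (k : nat) : set (borel R n) :=
  if (unpickle k : option ('cV[rat]_n * 'cV[rat]_n)) is Some pq then
    if `[< (forall j, pq.1 j 0 <= pq.2 j 0) /\
           forall x, box n (S pq.1) (S pq.2) x -> U x >]
    then [set x | box n (S pq.1) (S pq.2) x] else set0
  else set0.
have mF k : measurable (F k).
  rewrite /F; case: unpickle => // pq; case: ifP => // _; exact: measurable_box.
have F0 k : mu (F k) = 0%E.
  rewrite /F; case: unpickle => [pq|]; last exact: measure0.
  case: ifPn => [/asboolP[pq_le subU]|_]; last exact: measure0.
  apply/eqP; rewrite -measure_le0 leNgt; apply/negP => mu0.
  apply: noBox; exists (S pq.1), (S pq.2); split=> //.
    by move=> j; rewrite !mxE; do !split => //; rewrite lerD2l ler_rat.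
  rewrite fine_gt0// mu0/= (le_lt_trans (probability_le1 _ _)) ?ltry//.
  exact: measurable_box.
have UF : (U : set (borel R n)) `<=` \bigcup_k F k.
  move=> x Ux; have /nbhs_ballP[e /= e0 xe] : nbhs x U by exact: open_nbhs_nbhs.
  (* Rationals within [e] of [z j], one on each side, give a grid box that contains [x] and stays
     inside the ball of radius [e]. *)
  pose z (j : 'I_n) : R := (x : 'cV[R]_n) j 0 - tau.
  have lo j : exists q : rat, z j - e < ratr q < z j.
    have /rat_in_itvoo[q] : z j - e < z j by rewrite gtrBl.
    by rewrite in_itv/=; exists q.
  have hi j : exists q : rat, z j < ratr q < z j + e.
    have /rat_in_itvoo[q] : z j < z j + e by rewrite ltrDl.
    by rewrite in_itv/=; exists q.
  have [p hp] := choice lo; have [q hq] := choice hi; rewrite /z in hp hq.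
  pose pq : 'cV[rat]_n * 'cV[rat]_n := (\col_j p j, \col_j q j).
  exists (pickle pq) => //; rewrite /F pickleK ifT.
    apply/boxP => j; rewrite !mxE.
    by have /andP[_ h1] := hp j; have /andP[h2 _] := hq j; split=> [|_]; lra.
  apply/asboolP; split.
    move=> j; rewrite !mxE -(ler_rat R).
    by have /andP[_ h1] := hp j; have /andP[h2 _] := hq j; lra.
  move=> y /boxP Hy; apply: xe; split=> // i j; rewrite ord1.
  have [h1 h2] := Hy i; have {}h2 := h2 (ltn_ord i).
  rewrite !mxE in h1 h2; have /andP[h3 h4] := hp i; have /andP[h5 h6] := hq i.
  by rewrite /ball/= ltr_distlC; apply/andP; split; lra.
have mU : measurable (U : set (borel R n)) by exact: measurable_borel_open.
move: muU; rewrite lt0e => /andP[/eqP + _]; apply.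
apply: measure_negligible => //; apply: negligibleS UF _.
by apply: negligible_bigcup => k; exists (F k); split=> //; exact: F0.
Qed.

End box_frequencies.

(** * Lower bound on the Gram matrix of the sensors *)

Section gram_lower_bound.
Context {R : realType} {n : nat}.

Definition sensor_row (x : 'cV[R]_n) : 'rV[R]_(n + 1) := row_mx (- 2 *: x^T) 1%:M.

(** At [x = a i] this is entry [i] of [A h]. As a function of [x] it is affine, with gradient
    [-2 usubmx h] and constant term [dsubmx h]. *)
Definition sensor_form (h : 'cV[R]_(n + 1)) (x : 'cV[R]_n) : R :=
  (sensor_row x *m h) 0 0.

Lemma sensor_formE h x : sensor_form h x =
  - 2 * (x^T *m usubmx h) 0 0 + dsubmx h 0 0.
Proof.
rewrite /sensor_form /sensor_row -[in LHS](vsubmxK h) mul_row_col mul1mx.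
by rewrite -scalemxAl !mxE.
Qed.

Lemma sensor_formB h k x :
  sensor_form (h - k) x = sensor_form h x - sensor_form k x.
Proof. by rewrite /sensor_form mulmxBr !mxE. Qed.

Lemma sensor_formZ c h x : sensor_form (c *: h) x = c * sensor_form h x.
Proof. by rewrite /sensor_form -scalemxAr mxE. Qed.

Lemma cvg_sensor_form (T : Type) (F : set_system T) (FF : Filter F) h
    (y : T -> 'cV[R]_n) (l : 'cV[R]_n) :
  (forall j, y t j 0 @[t --> F] --> l j 0) ->
  sensor_form h (y t) @[t --> F] --> sensor_form h l.
Proof.
move=> yl; have formE x : sensor_form h x =
    - 2 * (\sum_j x j 0 * usubmx h j 0) + dsubmx h 0 0.
  rewrite sensor_formE mxE; congr (_ * _ + _).
  by apply: eq_bigr => j _; rewrite mxE.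
rewrite formE; under eq_fun do rewrite formE.
apply: cvgD; last exact: cvg_cst.
apply: cvgM; first exact: cvg_cst.
apply: cvg_big => [|j _]; first exact: add_continuous.
by apply: cvgM; [exact: yl|exact: cvg_cst].
Qed.

Lemma continuous_sensor_form h : continuous (sensor_form h).
Proof.
move=> x; apply: (cvg_sensor_form (nbhs_filter x)) => j.
exact: coord_continuous.
Qed.

(** With [u = usubmx h], the zero set is a translate of the orthogonal complement of [u], of which a
    row basis of [kermx u] provides the directions. *)
Lemma sensor_form_zero_affine (h : 'cV[R]_(n + 1)) :
  usubmx h != 0 -> affine_subspace n.-1 [set x | sensor_form h x = 0].
Proof.
set u := usubmx h => u0; set K := kermx u.
have rK : \rank K = n.-1.
  rewrite mxrank_ker -mxrank_tr rank_rV -subn1; congr (_ - _)%N.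
  by rewrite trmx_eq0 u0.
have uu0 : (u^T *m u) 0 0 != 0.
  rewrite mxE; under eq_bigr do rewrite mxE -expr2.
  apply: contra u0 => /eqP su; apply/eqP/colP => j; rewrite [RHS]mxE.
  have /psumr_eq0P := su; move=> /(_ (fun i _ => sqr_ge0 _)) /(_ j isT) /eqP.
  by rewrite sqrf_eq0 => /eqP.
(* [p] is the multiple of [u] on which the form vanishes, i.e. whose inner product with [u] is
   [e]. *)
pose e := dsubmx h 0 0 / 2; pose p := (e / (u^T *m u) 0 0) *: u.
have pu : (p^T *m u) 0 0 = e by rewrite linearZ/= -scalemxAl mxE divfK.
rewrite -rK; exists p, (row_base K)^T; split.
  by rewrite mxrank_tr (eq_row_base K).
have xpE x : ((x - p)^T *m u) 0 0 = (x^T *m u) 0 0 - e.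
  by rewrite linearB/= mulmxBl [LHS]mxE [X in _ + X]mxE pu.
have zeroE x : sensor_form h x = 0 <-> (x - p)^T *m u = 0.
  rewrite sensor_formE -/u; split=> [H|/matrixP/(_ 0 0)].
    by apply/matrixP => i j; rewrite !ord1 xpE [RHS]mxE /e; lra.
  by rewrite xpE [RHS]mxE /e; lra.
apply/seteqP; split=> [x /= /zeroE /sub_kermxP|_ [c _ <-]] /=.
  rewrite -/K -(eq_row_base K) => /submxP[D xD].
  exists D^T => //; rewrite -trmx_mul -xD trmxK addrC subrK //.
apply/zeroE; rewrite addrAC subrr add0r trmx_mul trmxK -mulmxA.
suff -> : row_base K *m u = 0 by rewrite mulmx0.
by apply/sub_kermxP; rewrite (eq_row_base K).
Qed.

Variables (mu : probability (borel R n) R) (a : nat -> 'cV[R]_n).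
Hypothesis A3 : forall t : 'cV[R]_n, {for t, continuous (dist_fun mu)} ->
  sample_df a m t @[m --> \oo] --> dist_fun mu t.
Hypothesis A6 : ~ exists S : set 'cV[R]_n,
    affine_subspace n.-1 S /\ mu S = 1%E.

(** If the linear part of the form is zero, the form is a nonzero constant. Otherwise its zero set
    is an affine hyperplane, which by (A6) does not have full mass. *)
Lemma sensor_form_not_null (h : 'cV[R]_(n + 1)) : h != 0 ->
  mu ([set x | sensor_form h x != 0] : set (borel R n)) != 0%E.
Proof.
move=> h0; have oU : open [set x | sensor_form h x != 0].
  have /continuousP cf := @continuous_sensor_form h.
  by apply: (cf [set y | y != 0]); exact: open_neq.
have mU := measurable_borel_open oU.
have [u0|u0] := eqVneq (usubmx h) 0.
  have d0 : dsubmx h 0 0 != 0.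
    apply: contra h0 => /eqP d0; rewrite -(vsubmxK h) u0.
    rewrite (_ : dsubmx h = 0) ?col_mx0//.
    by apply/matrixP => i j; rewrite !ord1 d0 mxE.
  rewrite (_ : mkset _ = setT) ?probability_setT ?oner_eq0//.
  apply/seteqP; split=> x //= _.
  by rewrite sensor_formE u0 mulmx0 mxE mulr0 add0r.
apply/eqP => mu0; apply: A6; exists [set x | sensor_form h x = 0]; split.
  exact: sensor_form_zero_affine.
rewrite (_ : mkset _ = ~` [set x | sensor_form h x != 0]).
  by rewrite probability_setC// mu0 sube0.
apply/seteqP; split=> x /=; first by move=> ->; apply/negP; rewrite eqxx.
by move/negP; rewrite negbK => /eqP.
Qed.

(** The nonvanishing set is the countable union of the open sets [|form| > 1/(k+1)], so one of these
    has positive mass and contains a generic box of positive mass. The sensors visit it with a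
    frequency that eventually exceeds half of that mass. *)
Lemma sensor_form_frequency (h : 'cV[R]_(n + 1)) : h != 0 ->
  exists2 delta : R, 0 < delta & exists2 beta : R, 0 < beta &
    \forall m \near \oo, beta <= freq a (fun x => delta < `|sensor_form h x|) m.
Proof.
move=> h0.
pose U (k : nat) : set 'cV[R]_n := [set x | k.+1%:R^-1 < `|sensor_form h x|].
have oU k : open (U k).
  rewrite (_ : U k = (fun x => `|sensor_form h x|) @^-1` `]k.+1%:R^-1, +oo[%classic).
    suff /continuousP : continuous (fun x => `|sensor_form h x|).
      by apply; exact: interval_open.
    move=> x; apply: continuous_comp; first exact: continuous_sensor_form.
    exact: norm_continuous.
  by apply/seteqP; split=> x /=; rewrite in_itv/= andbT.
have UE : [set x | sensor_form h x != 0] = \bigcup_k U k.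
  apply/seteqP; split=> x /=.
    by rewrite -normr_gt0 => /ltr_add_invr[k]; rewrite add0r; exists k.
  by move=> [k _ Uk]; rewrite -normr_gt0 (lt_trans _ Uk)// invr_gt0.
have mU k : measurable (U k : set (borel R n)) by exact: measurable_borel_open.
have [k muU] : exists k, (0 < mu (U k : set (borel R n)))%E.
  apply: contrapT => /forallNP H; have /negP := sensor_form_not_null h0; apply.
  apply/eqP; rewrite UE; apply: measure_negligible.
    exact: bigcupT_measurable.
  apply: negligible_bigcup => k; exists (U k); split=> //.
  by apply/eqP; rewrite -measure_le0 leNgt; apply/negP; exact: H.
have [s [t [gst sub beta0]]] := exists_generic_box (oU k) muU.
set beta := fine _ in beta0.
exists k.+1%:R^-1; first by rewrite invr_gt0.
exists (beta / 2); first by rewrite divr_gt0.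
have cv := box_freq_cvg A3 (leqnn n) gst.
have : \forall m \near \oo, beta / 2 < freq a (box n s t) m.
  by apply: (cvgr_gt _ cv); rewrite -/beta ltr_pdivrMr// mulr2n mulrDr mulr1 ltrDl.
apply: filterS => m /ltW /le_trans; apply.
rewrite /freq ler_wpM2r ?invr_ge0// ler_sum// => i _.
by have := sub (a i); case: box => [/(_ isT) ->|_]; rewrite ?ler0n.
Qed.

Lemma sensor_form_perturb (B e : R) (h k : 'cV[R]_(n + 1)) (x : 'cV[R]_n) :
  (forall j, `|sensor_row x 0 j| <= B) -> (forall j, `|h j 0 - k j 0| <= e) ->
  `|sensor_form h x - sensor_form k x| <= (n + 1)%:R * (B * e).
Proof.
move=> rB hk; rewrite -sensor_formB /sensor_form mxE.
apply: le_trans (ler_norm_sum _ _ _) _.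
apply: (@le_trans _ _ (\sum_(j < n + 1) B * e)); last first.
  by rewrite sumr_const card_ord mulr_natl.
apply: ler_sum => j _; rewrite normrM !mxE ler_pM//.
  by have := rB j; rewrite mxE.
Qed.

Hypothesis bounded_a : exists B : R, forall i j, `|a i j 0| <= B.

Lemma sensor_row_bounded : exists2 B : R, 0 < B &
  forall i j, `|sensor_row (a i) 0 j| <= B.
Proof.
have [B0 aB0] := bounded_a; exists (2 * `|B0| + 1); first by rewrite ltr_wpDl// mulr_ge0.
move=> i j; rewrite /sensor_row mxE; case: splitP => k _; rewrite !mxE.
  rewrite normrM normrN [`|2|]ger0_norm//.
  have := aB0 i k; have := ler_norm B0; lra.
by rewrite [k]ord1 eqxx normr1 lerDr mulr_ge0.
Qed.

(** Both sides are homogeneous of degree 2 in [h], so it suffices to treat the unit sphere, where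
    compactness makes the pointwise bounds of [sensor_form_frequency] uniform. *)
Lemma gram_lower_bound : exists2 c : R, 0 < c & exists M : nat,
  forall m, (M <= m)%N -> forall h : 'cV[R]_(n + 1),
  c * m%:R * \sum_j h j 0 ^+ 2 <= \sum_(i < m) sensor_form h (a i) ^+ 2.
Proof.
have [B B_gt0 aB] := sensor_row_bounded.
pose K : set 'rV[R]_(n + 1) := [set v | \sum_j v 0 j ^+ 2 = 1].
have cK : compact K.
  apply: bounded_closed_compact.
    exists 1; split => // b b1 v Kv; apply/ltW; apply: le_lt_trans b1.
    rewrite [leLHS]/Num.norm/= mx_normrE; apply: bigmax_le => // -[i j] _ /=.
    rewrite (ord1 i) -(@ler_pXn2r _ 2)// ?nnegrE// expr1n real_normK ?num_real//.
    rewrite -Kv (bigD1 j)//= lerDl.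
    by apply: sumr_ge0 => l _; exact: sqr_ge0.
  have cq : continuous (fun v : 'rV[R]_(n + 1) => \sum_j v 0 j ^+ 2).
    have cvg_sqr_sum (F : set_system 'rV[R]_(n + 1)) (FF : Filter F)
        (l : 'rV[R]_(n + 1)) :
        (forall j, v 0 j @[v --> F] --> l 0 j) ->
        \sum_j v 0 j ^+ 2 @[v --> F] --> \sum_j l 0 j ^+ 2.
      move=> vl; apply: cvg_big => [|j _]; first exact: add_continuous.
      by under eq_fun do rewrite expr2; rewrite expr2; apply: cvgM; exact: vl.
    move=> v; apply: (cvg_sqr_sum _ (nbhs_filter v)) => j.
    exact: coord_continuous.
  move/continuous_closedP : cq => cq; apply: (cq [set y | y = 1]).
  exact: closed_eq.
(* A single index [k] carries both the constant [1/(k+1)] and the threshold on [m], so that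
   uniformity over the sphere is one statement about all large [k]. *)
pose Pr (k : nat) (v : 'rV[R]_(n + 1)) := forall m, (k <= m)%N ->
  k.+1%:R^-1 * m%:R <= \sum_(i < m) sensor_form v^T (a i) ^+ 2.
have [k _ /(_ k (leqnn k)) Kk] : \forall k \near \oo, K `<=` Pr k.
  move/compact_near_coveringP : cK => cK; apply: cK => v Kv.
  have v0 : v^T != 0.
    apply/eqP => v0; have : (1 : R) = 0; last by move/eqP; rewrite oner_eq0.
    rewrite -Kv big1// => j _; have -> : v = 0 by rewrite -(trmxK v) v0 trmx0.
    by rewrite mxE expr0n.
  have [delta delta0 [beta beta0 [M _ freqM]]] := sensor_form_frequency v0.
  (* Moving [v] by at most [e] in each coordinate changes the form at any sensor by at most
     [delta / 2]. *)
  pose e := delta / (2 * ((n + 1)%:R * B)).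
  have nB0 : 0 < (n + 1)%:R * B by rewrite mulr_gt0// ltr0n addn1.
  have e0 : 0 < e by rewrite divr_gt0// mulr_gt0.
  (* At least [beta m] sensors have form above [delta] at [v], hence at least [delta / 2] at a
     nearby [w]; their squares add up to at least [g m]. *)
  pose g := beta * (delta / 2) ^+ 2.
  have g0 : 0 < g by rewrite mulr_gt0// exprn_gt0// divr_gt0.
  (* [k >= truncn g^-1] ensures [1/(k+1) <= g]. *)
  exists (ball v e, [set k | (maxn M (Num.truncn g^-1) <= k)%N]); first split=> /=.
  - exact: nbhsx_ballx.
  - by exists (maxn M (Num.truncn g^-1)).
  move=> [w k] /= [[_ vw]]; rewrite geq_max => /andP[Mk gk] m km.
  have Mm : (M <= m)%N := leq_trans Mk km.
  apply: (@le_trans _ _ (g * m%:R)).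
    rewrite ler_wpM2r// invf_ple ?posrE//.
    by apply/ltW/(lt_le_trans (truncnS_gt _)); rewrite ler_nat.
  have := freqM m Mm; rewrite /freq /=.
  have [->|m0] := posnP m; first by rewrite mulr0 !big_ord0.
  rewrite ler_pdivlMr ?ltr0n// => bm.
  rewrite /g mulrAC.
  apply: (@le_trans _ _ ((\sum_(i < m) (delta < `|sensor_form v^T (a i)|)%R%:R) *
      (delta / 2) ^+ 2)).
    by rewrite ler_wpM2r// sqr_ge0.
  rewrite mulr_suml; apply: ler_sum => i _.
  case: ltP => [di|_]; last by rewrite mul0r sqr_ge0.
  rewrite mul1r -[leRHS]real_normK ?num_real// ler_pXn2r ?nnegrE// ?divr_ge0 ?ltW//.
  have : `|sensor_form v^T (a i) - sensor_form w^T (a i)| <= delta / 2.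
    apply: le_trans (@sensor_form_perturb B e _ _ _ (aB i) _) _.
      by move=> j; rewrite !mxE; exact/ltW/vw.
    rewrite mulrA /e le_eqVlt; apply/orP; left; apply/eqP.
    by field; rewrite !gt_eqF// ltr0n addn1.
  have := lerB_dist (sensor_form v^T (a i)) (sensor_form w^T (a i)); lra.
exists k.+1%:R^-1; first by rewrite invr_gt0.
exists k => m km h.
pose N2 := \sum_j h j 0 ^+ 2.
have N2_ge0 : 0 <= N2 by apply: sumr_ge0 => j _; exact: sqr_ge0.
have [N20|N2_neq0] := eqVneq N2 0.
  by rewrite -/N2 N20 mulr0; apply: sumr_ge0 => i _; exact: sqr_ge0.
have sN : Num.sqrt N2 ^+ 2 = N2 by rewrite sqr_sqrtr.
have sN0 : Num.sqrt N2 != 0 by rewrite sqrtr_eq0 -ltNge lt0r N2_neq0.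
have Kv : K ((Num.sqrt N2)^-1 *: h^T).
  rewrite /K /=; under eq_bigr do rewrite !mxE exprMn.
  by rewrite -mulr_sumr -/N2 exprVn sN mulVf.
have := Kk _ Kv m km; rewrite linearZ/= trmxK.
under eq_bigr do rewrite sensor_formZ exprMn.
rewrite -mulr_sumr exprVn sN -/N2.
by rewrite [leRHS]mulrC ler_pdivlMr// lt0r N2_neq0.
Qed.

End gram_lower_bound.

(** * Error of the Noise-Est estimator *)

Section noise_est_error.
Context {R : realType} {n : nat}.

Lemma enorm_sqr k (v : 'cV[R]_k) : enorm v ^+ 2 = \sum_j v j 0 ^+ 2.
Proof. by rewrite sqr_sqrtr// sumr_ge0// => j _; rewrite sqr_ge0. Qed.

(** The constraint takes the value [|xo|^2 - (|xo|^2 + s^2) = - s^2] there. *)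
Lemma NE_target_feasible (xo : 'cV[R]_n) (s : R) : NE_feasible (NE_target xo s).
Proof.
rewrite /NE_feasible /NE_target /NE_D /NE_g !tr_col_mx mul_row_block.
rewrite !mulmx0 !addr0 mulmx1 mul_row_col mul0mx addr0 mul_row_col.
rewrite trmx0 mul0mx add0r tr_scalar_mx -scalar_mxM !mxE eqxx mulr1n.
have -> : \sum_j xo^T 0 j * xo j 0 = enorm xo ^+ 2.
  by rewrite enorm_sqr; apply: eq_bigr => j _; rewrite mxE expr2.
have -> : 2 * (- 2^-1 * (enorm xo ^+ 2 + s ^+ 2)) = - (enorm xo ^+ 2 + s ^+ 2) by field.
by rewrite opprD addrA subrr add0r oppr_le0 sqr_ge0.
Qed.

Variables (a : nat -> 'cV[R]_n) (xo : 'cV[R]_n) (rr : nat -> R) (s : R).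

Definition noise (i : nat) : R :=
  2 * enorm (a i - xo) * rr i + (rr i ^+ 2 - s ^+ 2).

Lemma NE_A_mulE m (h : 'cV[R]_(n + 1)) i :
  (NE_A a m *m h) i 0 = sensor_form h (a i).
Proof.
by rewrite /sensor_form !mxE; apply: eq_bigr => k _; rewrite /NE_A !mxE.
Qed.

(** Expand [(|a_i - xo| + r_i)^2 - |a_i|^2]. The [s^2] in the last entry of the target absorbs the
    mean of [r_i^2], which leaves a centred residual. *)
Lemma NE_bE m (i : 'I_m) : NE_b a (range_meas a xo rr) m i 0 =
  sensor_form (NE_target xo s) (a i) + noise i.
Proof.
have normE : enorm (a i - xo) ^+ 2 =
    enorm (a i) ^+ 2 - 2 * ((a i)^T *m xo) 0 0 + enorm xo ^+ 2.
  rewrite !enorm_sqr mxE mulr_sumr -sumrB -big_split; apply: eq_bigr => j _ /=.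
  by rewrite !mxE; ring.
have entryE (e : R) : (e%:M : 'M[R]_1) 0 0 = e by rewrite mxE eqxx mulr1n.
rewrite mxE /range_meas sensor_formE /NE_target col_mxKu col_mxKd entryE.
by rewrite sqrrD normE /noise; ring.
Qed.

(** Put [k = c m], with [W] the vector [A^T e]. Optimality against the target gives
    [|A h - e|^2 <= |e|^2], so [k |h|^2 <= 2 <h, W>]. Multiplying by [k] and bounding [2 k <h, W>]
    by [k^2 |h|^2 / 2 + 2 |W|^2] yields the factor 4. *)
Lemma NE_optimal_error (m : nat) (c : R) (y : 'cV[R]_(n + 1)) :
  0 < c -> (0 < m)%N ->
  (forall h : 'cV[R]_(n + 1),
    c * m%:R * \sum_j h j 0 ^+ 2 <= \sum_(i < m) sensor_form h (a i) ^+ 2) ->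
  NE_optimal (NE_A a m) (NE_b a (range_meas a xo rr) m) y ->
  (c * m%:R) ^+ 2 * \sum_j (y - NE_target xo s) j 0 ^+ 2 <=
  4 * \sum_j (\sum_(i < m) sensor_row (a i) 0 j * noise i) ^+ 2.
Proof.
move=> c0 m0 gram [_ /(_ _ (NE_target_feasible xo s))].
set yo := NE_target xo s; set h := y - yo.
have resE z : enorm (NE_A a m *m z - NE_b a (range_meas a xo rr) m) ^+ 2 =
    \sum_(i < m) (sensor_form (z - yo) (a i) - noise i) ^+ 2.
  rewrite enorm_sqr; apply: eq_bigr => i _; congr (_ ^+ 2).
  by rewrite mxE [X in _ + X]mxE NE_A_mulE NE_bE -/yo sensor_formB opprD addrA.
rewrite !resE subrr -/h => opt.
have crossE : \sum_(i < m) sensor_form h (a i) * noise i =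
    \sum_j h j 0 * \sum_(i < m) sensor_row (a i) 0 j * noise i.
  under eq_bigr do rewrite /sensor_form mxE mulr_suml.
  rewrite exchange_big/=; apply: eq_bigr => j _; rewrite mulr_sumr.
  by apply: eq_bigr => i _; ring.
set W := fun j => \sum_(i < m) sensor_row (a i) 0 j * noise i.
have opt2 : \sum_(i < m) sensor_form h (a i) ^+ 2 <= 2 * \sum_j h j 0 * W j.
  rewrite -crossE mulr_sumr -subr_le0 -sumrB -(lerD2r (\sum_(i < m) noise i ^+ 2)) add0r.
  rewrite -big_split/=; apply: le_trans (le_trans _ opt) _.
    by rewrite le_eqVlt; apply/orP; left; apply/eqP/eq_bigr => i _; ring.
  rewrite le_eqVlt; apply/orP; left; apply/eqP/eq_bigr => i _.
  by rewrite /sensor_form mulmx0 mxE sub0r sqrrN.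
have {}gram := le_trans (gram h) opt2.
set k := c * m%:R in gram *.
have k0 : 0 < k by rewrite mulr_gt0// ltr0n.
have : k * (k * \sum_j h j 0 ^+ 2) <= k * (2 * \sum_j h j 0 * W j) by rewrite ler_pM2l.
(* AM-GM: [4 k h W <= k^2 h^2 + 4 W^2] *)
have amgm : 4 * k * \sum_j h j 0 * W j <=
    k ^+ 2 * (\sum_j h j 0 ^+ 2) + 4 * \sum_j W j ^+ 2.
  rewrite !mulr_sumr -big_split/=; apply: ler_sum => j _.
  have := sqr_ge0 (k * h j 0 - 2 * W j); lra.
rewrite -/W; nra.
Qed.

End noise_est_error.

(** * Markov's inequality and the conclusion *)

Section markov.
Context d (T : measurableType d) (R : realType) (P : probability T R).

(** Stated for an event merely contained in [lambda <= Z], as the deviation event of the estimator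
    will be. *)
Lemma ge0_markov (A : set T) (Z : T -> R) (lambda : R) :
  measurable A -> measurable_fun [set: T] Z -> (forall w, 0 <= Z w) ->
  0 <= lambda -> (forall w, A w -> lambda <= Z w) ->
  (lambda%:E * P A <= \int[P]_w (Z w)%:E)%E.
Proof.
move=> mA mZ Z0 l0 AZ; rewrite -integral_cst//.
have mEZ : measurable_fun setT (EFin \o Z) by exact/measurable_EFinP.
apply: (@le_trans _ _ (\int[P]_(w in A) (Z w)%:E)%E).
  apply: ge0_le_integral => //.
  exact: measurable_funTS mEZ.
apply: ge0_subset_integral => //.
by move=> w _; rewrite lee_fin.
Qed.

End markov.

Theorem theorem5
  (R : realType) (d : measure_display) (T : measurableType d)
  (P : probability T R)
  (n : nat) (hn : n = 2%N \/ n = 3%N)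
  (sigma : R) (hsigma : 0 <= sigma)
  (r : nat -> {RV P >-> R})
  (A1 : iid_gaussian r 0 sigma)
  (calX calA : set 'cV[R]_n) (xo : 'cV[R]_n) (a : nat -> 'cV[R]_n)
  (A2_compact : compact calX)
  (A2_interior : interior calX xo)
  (A2_bounded : bounded_set calA)
  (A2_sensors : forall i : nat, calA (a i))
  (A2_notin : forall i : nat, ~ calX (a i))
  (mu : probability (borel R n) R)
  (A3 : forall t : 'cV[R]_n, {for t, continuous (dist_fun mu)} ->
    sample_df a m t @[m --> \oo] --> dist_fun mu t)
  (A6 : ~ exists S : set 'cV[R]_n,
    affine_subspace n.-1 S /\ mu S = 1%E)
  (yNE : nat -> T -> 'cV[R]_(n + 1))
  (yNE_meas : forall m : nat,
    measurable_fun [set: T] (yNE m : T -> borel R (n + 1)))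
  (yNE_opt : forall (m : nat) (w : T),
    NE_optimal (NE_A a m)
      (NE_b a (range_meas a xo (fun i => r i w)) m) (yNE m w)) :
  bigOp P (fun m w => yNE m w - NE_target xo sigma)
    (fun m => 1 / Num.sqrt m%:R).
Proof.
have [B [_ aB]] := A2_bounded.
have bnd_a : exists B' : R, forall i j, `|a i j 0| <= B'.
  (* Boundedness gives a norm bound by every real above [B], hence [B + 1]; the norm being the sup
     norm, it controls each coordinate. *)
  exists (B + 1) => i j; have := aB (B + 1) _ _ (A2_sensors i).
  rewrite ltrDl ltr01 => /(_ isT); apply: le_trans.
  by rewrite [leRHS]/Num.norm/= mx_normrE; apply/bigmax_geP; right; exists (j, 0).
have [c c0 [M gram]] := gram_lower_bound A3 A6 bnd_a.
have [Br Br0 rowB] := sensor_row_bounded bnd_a.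
pose rho i := 2 * enorm (a i - xo).
have [rho0 rho_le] : exists rho0 : R, forall i, `|rho i| <= rho0.
  have [B' aB'] := bnd_a.
  exists (2 * Num.sqrt (\sum_(j < n) (B' + `|xo j 0|) ^+ 2)) => i.
  rewrite /rho ger0_norm ?mulr_ge0 ?sqrtr_ge0// ler_pM2l// ler_wsqrtr//.
  apply: ler_sum => j _; rewrite !mxE -[leLHS]real_normK ?num_real//.
  have B'0 : 0 <= B' := le_trans (normr_ge0 _) (aB' i j).
  rewrite ler_pXn2r ?nnegrE ?addr_ge0//.
  by rewrite (le_trans (ler_normB _ _))// lerD2r.
have [K K0 noiseK] := gaussian_noise_second_moment A1 rho_le.
move=> eps eps0.
(* [W m k] is entry [k] of [A^T e], and [Z m] below is [|A^T e|^2], of expectation at most [C m]. *)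
pose W m (k : 'I_(n + 1)) w :=
  \sum_(i < m) sensor_row (a i) 0 k * noise a xo (fun i => r i w) sigma i.
have WK m k : P.-integrable [set: T] (fun w => (W m k w ^+ 2)%:E) /\
    (\int[P]_w (W m k w ^+ 2)%:E <= (K * (m%:R * Br ^+ 2))%:E)%E.
  have [iW leW] := noiseK (fun i => sensor_row (a i) 0 k) m.
  split; first exact: iW.
  apply: le_trans leW _; rewrite lee_fin ler_wpM2l//.
  apply: (@le_trans _ _ (\sum_(i < m) Br ^+ 2)); last first.
    by rewrite sumr_const card_ord mulr_natl.
  apply: ler_sum => i _; rewrite -[leLHS]real_normK ?num_real//.
  by rewrite ler_pXn2r ?nnegrE// ltW.
pose Z m w := \sum_k W m k w ^+ 2.
have ZK m : measurable_fun [set: T] (Z m) /\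
    (\int[P]_w (Z m w)%:E <= ((n + 1)%:R * (K * (m%:R * Br ^+ 2)))%:E)%E.
  have ZE : EFin \o Z m = (fun w => \sum_k (W m k w ^+ 2)%:E)%E.
    by apply/funext => w; rewrite /= sumEFin.
  have iZ : P.-integrable [set: T] (EFin \o Z m).
    by rewrite ZE; apply: integrable_sum => // k _; exact: (WK m k).1.
  split; first by apply/measurable_EFinP; exact: measurable_int iZ.
  rewrite [X in integral _ _ X]ZE integral_sum//; last by move=> k; exact: (WK m k).1.
  apply: (@le_trans _ _ (\sum_(k < n + 1) (K * (m%:R * Br ^+ 2))%:E)%E).
    by apply: lee_sum => k _; exact: (WK m k).2.
  by rewrite sumEFin lee_fin sumr_const card_ord [leRHS]mulr_natl.
pose C := (n + 1)%:R * (K * Br ^+ 2).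
have C0 : 0 <= C by rewrite /C mulr_ge0// mulr_ge0// sqr_ge0.
(* The quotient, together with the extra 1, gives [4 C < c^2 eps N]; the 1 also gives [N <= N^2]. *)
pose N := 1 + 4 * C / (c ^+ 2 * eps).
have N1 : 1 <= N by rewrite lerDl divr_ge0// mulr_ge0// ?sqr_ge0// ltW.
exists M, N => m Mm.
have m0 : (0 < m)%N by exact: leq_ltn_trans Mm.
have mR0 : 0 < m%:R :> R by rewrite ltr0n.
set E := [set w | _].
pose h w := yNE m w - NE_target xo sigma.
have alphaE w : enorm ((1 / Num.sqrt m%:R)^-1 *: h w) ^+ 2 = m%:R * \sum_j h w j 0 ^+ 2.
  rewrite enorm_sqr mulr_sumr; apply: eq_bigr => j _.
  by rewrite mxE exprMn div1r invrK sqr_sqrtr// ler0n.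
have N0 : 0 <= N := le_trans ler01 N1.
(* Squaring turns the event into a strict inequality on a polynomial in the coordinates of the
   estimator, which are measurable. *)
have mE : measurable E.
  have mG : measurable_fun [set: T] (fun w => m%:R * \sum_j h w j 0 ^+ 2).
    apply: measurable_funM => //; apply: measurable_sum => j.
    apply: measurable_funX; under eq_fun do rewrite /h mxE [X in _ + X]mxE.
    apply: measurable_funB => //.
    exact: measurableT_comp (@measurable_coord R (n + 1) j) (yNE_meas m).
  rewrite (_ : E =
      [set: T] `&` (fun w => m%:R * \sum_j h w j 0 ^+ 2) @^-1` `]N ^+ 2, +oo[).
    by apply: mG => //; exact: measurable_itv.
  rewrite setTI; apply/seteqP; split=> w; rewrite /E /= in_itv/= andbT -alphaE;
    by rewrite ltr_pXn2r ?nnegrE ?sqrtr_ge0.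
(* On [E], [m |h|^2 >= N^2], so [(c m)^2 |h|^2 <= 4 Z] forces [Z] to be at least this value. *)
pose lambda := (c * N) ^+ 2 * m%:R / 4.
have lambda0 : 0 < lambda.
  by rewrite divr_gt0// mulr_gt0// exprn_gt0// mulr_gt0// (lt_le_trans _ N1).
have EZ w : E w -> lambda <= Z m w.
  rewrite /E /= => Nh.
  have := NE_optimal_error sigma c0 m0 (gram m (ltnW Mm)) (yNE_opt m w).
  rewrite -/(h w) -/(Z m w) => err.
  have : N ^+ 2 <= m%:R * \sum_j h w j 0 ^+ 2.
    by rewrite -alphaE ler_pXn2r ?nnegrE ?sqrtr_ge0// ltW.
  have cm0 : 0 <= c ^+ 2 * m%:R by rewrite mulr_ge0// sqr_ge0.
  by move=> /(ler_wpM2l cm0); rewrite /lambda; lra.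
have [mZ intZ] := ZK m.
have Z0 w : 0 <= Z m w by apply: sumr_ge0 => k _; exact: sqr_ge0.
have := le_trans (ge0_markov P mE mZ Z0 (ltW lambda0) EZ) intZ.
have PE : P E = (fine (P E))%:E by rewrite fineK// fin_num_measure.
rewrite PE -EFinM lee_fin lte_fin => PEle.
(* If [P E >= eps], Markov gives [lambda eps <= C m], that is [c^2 eps N^2 <= 4 C], against the
   choice of [N]. *)
rewrite ltNge; apply/negP => le_eps.
have : lambda * eps <= (n + 1)%:R * (K * (m%:R * Br ^+ 2)).
  by apply: le_trans PEle; rewrite ler_wpM2l// ltW.
have -> : (n + 1)%:R * (K * (m%:R * Br ^+ 2)) = C * m%:R by rewrite /C; ring.
have -> : lambda * eps = (c ^+ 2 * eps * N ^+ 2 / 4) * m%:R by rewrite /lambda; field.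
have ce0 : 0 < c ^+ 2 * eps by rewrite mulr_gt0// exprn_gt0.
have CN : 4 * C < c ^+ 2 * eps * N.
  by rewrite /N mulrDr mulr1 [_ * (_ / _)]mulrC divfK ?gt_eqF// ltrDr.
have NN : c ^+ 2 * eps * N <= c ^+ 2 * eps * N ^+ 2.
  by rewrite ler_pM2l// expr2 ler_peMr.
by rewrite ler_pM2r// leNgt => /negP; apply; lra.
Qed.
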